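(* Let $G$ be a Polish group, $X$ a standard Borel $G$-space with Borel action $\alpha : G \times X \to X$, and $\mathcal{S} \subseteq \mathcal{B}(X)$ a compatible $\sigma$-topology such that $\mathcal{O}(G) \circledast \mathcal{S} \subseteq \mathcal{S}$. Then $\mathcal{B}(G) \circledast \mathcal{S} = \mathcal{O}(G) \circledast \mathcal{S}$, and for any Borel $A \subseteq X$ the following are equivalent: (i) $A$ is open in some quasi-Polish topology $\mathcal{O}(X) \subseteq \mathcal{S}$ making the action continuous; (ii) $A \in \mathcal{O}(G) \circledast \mathcal{S}$, i.e., $A = \bigcup_i (U_i * A_i)$ for countably many $U_i \in \mathcal{B}(G)$ (equivalently, $U_i \in \mathcal{O}(G)$) and $A_i \in \mathcal{S}$; (iii) $\alpha^{-1}(A) \in \mathcal{B}(G) \otimes \mathcal{S}$; (iv) $\alpha^{-1}(A) \in \mathcal{O}(G) \otimes \mathcal{S}$; (v) $\alpha^{-1}(A) \in \mathcal{O}(G) \otimes (\mathcal{O}(G) \circledast \mathcal{S})$; (vi) every translate $g \cdot A$ ($g \in G$) belongs to $\mathcal{S}$, and there are countably many sets in $\mathcal{S}$ generating all such translates under unions. In particular every $G$-invariant $A \in \mathcal{S}$ satisfies these conditions. Moreover, countably many Borel sets satisfying these conditions can be made simultaneously open in a single quasi-Polish topology $\mathcal{O}(X) \subseteq \mathcal{S}$ making the action continuous.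
   Context: $\mathcal{B}(Z)$ is the Borel $\sigma$-algebra, $\mathcal{O}(Z)$ the topology. A $\sigma$-topology on a set is a family of subsets closed under finite intersections and countable unions. A quasi-Polish topology (de Brecht) on a standard Borel space $X$ is compatible if it is contained in $\mathcal{B}(X)$. A $\sigma$-topology $\mathcal{S} \subseteq \mathcal{B}(X)$ is compatible if every countable subset of $\mathcal{S}$ is contained in some compatible quasi-Polish topology which is itself contained in $\mathcal{S}$. For families $\mathcal{S} \subseteq \mathcal{P}(Y)$, $\mathcal{T} \subseteq \mathcal{P}(Z)$, $\mathcal{S} \otimes \mathcal{T}$ denotes the family of countable unions of rectangles $S \times T$ with $S \in \mathcal{S}$, $T \in \mathcal{T}$. Vaught transform: for Borel $U \subseteq G$, $A \subseteq X$, $U * A := \{x \in X \mid \exists^* g \in G\,(g \in U \text{ and } x \in gA)\}$ ($\exists^*$ = ''for nonmeagerly many''); $\mathcal{O}(G) \circledast \mathcal{S}$ (resp. $\mathcal{B}(G) \circledast \mathcal{S}$) is the set of countable unions of $U_i * A_i$ with $U_i \in \mathcal{O}(G)$ (resp. $\mathcal{B}(G)$), $A_i \in \mathcal{S}$. *)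

(* Defs.v *)
(* A set may carry several topologies and sigma-topologies at once, so these,
   as well as Borel structures, are families of subsets (set_system X).  Only
   the Polish group carries its topology canonically. *)
From HB Require Import structures.
From mathcomp Require Import all_boot all_order all_algebra.
From mathcomp Require Import all_classical all_reals all_analysis.

Set Implicit Arguments.
Unset Strict Implicit.
Unset Printing Implicit Defensive.

Import Order.TTheory GRing.Theory Num.Theory.
Local Open Scope classical_set_scope.

HB.mixin Record isTopologicalGroup G & Group G & Topological G := {
  mulg_continuous : continuous (fun gh : G * G => (gh.1 * gh.2)%g) ;
  invg_continuous : continuous (fun g : G => g^-1%g)
}.

#[short(type="topologicalGroupType")]
HB.structure Definition TopologicalGroup :=
  {G of Group G & Topological G & isTopologicalGroup G}.

Section SetFamilies.
Variables (T U : Type).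
Implicit Types (F D : set_system T).

Definition unions F : set_system T :=
  [set A | exists2 D, D `<=` F & A = \bigcup_(B in D) B].

(* [countable D] allows D to be finite or empty. *)
Definition countable_unions F : set_system T :=
  [set A | exists D, [/\ countable D, D `<=` F & A = \bigcup_(B in D) B]].

Definition rectangles F (H : set_system U) : set_system (T * U) :=
  [set A `*` B | A in F & B in H].

Definition countably_based F : Prop :=
  exists D, [/\ countable D, D `<=` F & F `<=` unions D].

(* [S setT] is closure under the empty intersection; closure under the empty
   union is the case D = set0. *)
Definition sigma_topology (S : set_system T) : Prop :=
  [/\ S setT, setI_closed S & countable_unions S `<=` S].

End SetFamilies.

Definition otimes (T U : Type) (S : set_system T) (H : set_system U) :=
  countable_unions (rectangles S H).

(* Meant for topologies S and H, whose rectangles form a base. *)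
Definition product_topology (T U : Type) (S : set_system T) (H : set_system U) :=
  unions (rectangles S H).

Section QuasiMetric.
Local Open Scope ring_scope.
Variables (R : realType) (T : Type).
Implicit Types (d : T -> T -> R) (O : set_system T).

Definition quasi_metric d : Prop :=
  [/\ forall x y, 0 <= d x y,
      forall x y, (d x y = 0 /\ d y x = 0) <-> x = y &
      forall x y z, d x z <= d x y + d y z].

Definition quasi_metric_topology d : set_system T :=
  [set A | forall x, A x -> exists2 e : R, 0 < e & [set y | d x y < e] `<=` A].

Definition quasi_cauchy d (u : nat -> T) : Prop :=
  forall e : R, 0 < e -> exists N, forall n m, (N <= n <= m)%N -> d (u n) (u m) < e.

(* Cauchy sequences are one-sided, but the limit is taken with respect to the
   symmetrized metric max (d x y) (d y x), as in de Brecht's definition. *)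
Definition complete_quasi_metric d : Prop :=
  forall u, quasi_cauchy d u -> exists l, forall e : R, 0 < e ->
    exists N, forall n, (N <= n)%N -> Num.max (d l (u n)) (d (u n) l) < e.

Definition quasi_polish_topology O : Prop :=
  countably_based O /\
  exists d, [/\ quasi_metric d, complete_quasi_metric d
              & O = quasi_metric_topology d].

(* For a symmetric quasi-metric the notions above are the usual ones of
   complete metric and metric topology. *)
Definition polish_topology O : Prop :=
  countably_based O /\
  exists d, [/\ quasi_metric d, (forall x y, d x y = d y x),
                complete_quasi_metric d & O = quasi_metric_topology d].

End QuasiMetric.

Definition standard_borel (R : realType) (X : Type) (BX : set_system X) : Prop :=
  exists2 O, polish_topology R O & BX = <<s O >>.

Definition compatible_topology (R : realType) (X : Type) (BX O : set_system X) :=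
  quasi_polish_topology R O /\ O `<=` BX.

Definition compatible_sigma_topology (R : realType) (X : Type)
    (BX S : set_system X) : Prop :=
  [/\ sigma_topology S, S `<=` BX &
      forall D, countable D -> D `<=` S ->
        exists O, [/\ compatible_topology R BX O, D `<=` O & O `<=` S]].

Definition borel (T : topologicalType) : set_system T := <<s @open T >>.
Arguments borel T : clear implicits.

Definition nowhere_dense (T : topologicalType) (A : set T) : Prop :=
  (closure A)° = set0.

Definition meager (T : topologicalType) (A : set T) : Prop :=
  exists2 F : nat -> set T,
    forall n, nowhere_dense (F n) & A = \bigcup_n F n.

Section Action.
Variables (G : topologicalGroupType) (X : Type).
Implicit Types (alpha : G * X -> X) (A : set X) (U : set G) (S O : set_system X).

Definition is_action alpha : Prop :=
  (forall x, alpha (1%g, x) = x) /\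
  (forall (g h : G) x, alpha ((g * h)%g, x) = alpha (g, alpha (h, x))).

Definition borel_action (BX : set_system X) alpha : Prop :=
  forall A, BX A -> <<s rectangles (borel G) BX >> (alpha @^-1` A).

Definition continuous_action O alpha : Prop :=
  forall A, O A -> product_topology (@open G) O (alpha @^-1` A).

Definition translate alpha (g : G) A : set X := [set alpha (g, x) | x in A].

Definition vaught alpha U A : set X :=
  [set x | ~ meager [set g | U g /\ translate alpha g A x]].

Definition vaught_unions alpha (W : set_system G) S : set_system X :=
  countable_unions [set vaught alpha U A | U in W & A in S].

End Action.

(* Main.v *)
(* Quasi-Polish topologies are handled through countable bases together with
   countably many covering rules "b i `&` b j is covered by the b k, k in q",
   such that every upward closed set of indices obeying the rules is the set of
   basic neighborhoods of a point.  Every complete quasi-metric yields such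
   rules; conversely, a quasi-metric is obtained by comparing, for each rule,
   the least index at which its conclusion is realized.

   If f : Z -> X has a notion of largeness on its fibers given by sigma-ideals,
   and the set of points with large fiber in each basic open set has an open
   preimage, these sets are the base of such a topology on X: a system of
   indices obeying suitable rules is realized by the image of a point of Z built
   by a generic sequence of basic open sets.  Applied to the action on G * X,
   with nonmeagerness as largeness, this turns a quasi-Polish topology closed
   under Vaught transforms into one making the action continuous, its base
   being the sets U * A.  A topology closed under Vaught transforms is
   generated by an increasing sequence of quasi-Polish topologies contained in
   S, each containing the transforms of the basic sets of the previous one. *)
Require Import Defs.
From mathcomp Require Import all_boot all_order all_algebra.
From mathcomp Require Import all_classical all_reals all_analysis.
From mathcomp Require Import lra.

Set Implicit Arguments.
Unset Strict Implicit.
Unset Printing Implicit Defensive.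

Import Order.TTheory GRing.Theory Num.Theory.
Local Open Scope classical_set_scope.

(** * Bases presented by covering rules *)

Lemma countable_image (T U : Type) (f : T -> U) (D : set T) :
  countable D -> countable (f @` D).
Proof. by apply: card_le_trans; apply: card_image_le. Qed.

(* The rule of index j states that b (prem1 j) `&` b (prem2 j) is covered by
   the b i for i in concl j. *)
Record rules (I : Type) := Rules {
  rule_idx : countType ;
  prem1 : rule_idx -> I ;
  prem2 : rule_idx -> I ;
  concl : rule_idx -> set I }.

Arguments prem1 {I} r j.
Arguments prem2 {I} r j.
Arguments concl {I} r j.

Definition rule_closed (I : Type) (r : rules I) (s : set I) : Prop :=
  forall j, s (prem1 r j) -> s (prem2 r j) -> exists2 i, concl r j i & s i.

Section Presentations.
Variables (T : Type) (I : countType) (b : I -> set T).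

Definition base_topology : set_system T :=
  [set A | forall x, A x -> exists2 i, b i x & b i `<=` A].

Definition directed_base : Prop :=
  (exists i, b i = setT) /\
  forall i j x, b i x -> b j x -> exists2 k, b k x & b k `<=` b i `&` b j.

(** The T0 axiom for the topology with base [b]. *)
Definition separating : Prop :=
  forall x y, (forall i, b i x <-> b i y) -> x = y.

(** Soundness and completeness of the rules. The empty system obeys every rule vacuously, so only
    nonempty systems are required to come from points. *)
Definition presents (r : rules I) : Prop :=
  (forall x, rule_closed r [set i | b i x]) /\
  (forall s : set I, s !=set0 -> (forall i j, b i `<=` b j -> s i -> s j) ->
     rule_closed r s -> exists x, forall i, s i <-> b i x).

Definition quasi_polish_base : Prop :=
  [/\ directed_base, separating & exists r, presents r].

Lemma base_topology_base i : base_topology (b i).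
Proof. by move=> x bx; exists i. Qed.

Lemma base_topology_unions (D : set_system T) :
  D `<=` base_topology -> base_topology (\bigcup_(B in D) B).
Proof.
move=> sD x [B DB Bx]; have [i bx bB] := sD _ DB _ Bx.
by exists i => // y /bB; exists B.
Qed.

Lemma base_topology_unionsE : base_topology = unions (range b).
Proof.
apply/seteqP; split=> A.
  move=> oA; exists [set B | range b B /\ B `<=` A]; first by move=> B [].
  apply/seteqP; split=> x; last by move=> [B [_ sB]] /sB.
  by move=> /oA[i bx bA]; exists (b i) => //; split=> //; exists i.
move=> [D sD ->]; apply: base_topology_unions => B /sD[i _ <-].
exact: base_topology_base.
Qed.

(** The Rasiowa-Sikorski argument: countably many dense requirements are met one after the other,
    requirement [r] at step [pickle r]. *)
Lemma generic_chain (K : countType) (P : I -> Prop) (D : K -> I -> Prop) i0 :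
  P i0 -> (forall r i, P i -> exists k, [/\ P k, b k `<=` b i & D r k]) ->
  exists c : nat -> I, [/\ forall n, P (c n),
    (forall m n, (m <= n)%N -> b (c n) `<=` b (c m)) &
    forall r, exists n, D r (c n)].
Proof.
move=> Pi0 dense.
have /choice[F FP] : forall ri : K * I, exists k, P ri.2 ->
    [/\ P k, b k `<=` b ri.2 & D ri.1 k].
  move=> [r i]; have [/(dense r)[k kP]|nP] := pselect (P i); first by exists k.
  by exists i.
pose c := fix c n := if n is m.+1 then
  (if unpickle m is Some r then F (r, c m) else c m) else i0.
have cP n : P (c n).
  elim: n => [//|n IH] /=; case: unpickle => [r|//].
  by have /(_ IH)[] := FP (r, c n).
exists c; split=> //.
  move=> m; elim=> [|n IH]; first by rewrite leqn0 => /eqP->.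
  rewrite leq_eqVlt => /orP[/eqP->//|/IH] sub.
  apply: subset_trans sub; rewrite /=; case: unpickle => [r|//].
  by have /(_ (cP n))[] := FP (r, c n).
move=> r; exists (pickle r).+1 => /=; rewrite pickleK.
by have /(_ (cP (pickle r)))[] := FP (r, c (pickle r)).
Qed.

(* A rule j is dealt with once and for all along the chain: either some
   extension decides its premises, and then the rule is applied below that
   extension, or the premises never enter the filter generated by the chain. *)
Lemma generic_point (K : countType) (P : I -> Prop) (D : K -> I -> Prop) i0
    (r : rules I) :
  presents r -> P i0 ->
  (forall t i, P i -> exists k, [/\ P k, b k `<=` b i & D t k]) ->
  (forall j i, P i -> b i `<=` b (prem1 r j) `&` b (prem2 r j) ->
     exists k, [/\ P k, b k `<=` b i & exists2 l, concl r j l & b k `<=` b l]) ->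
  exists z, (forall t, exists k, [/\ P k, D t k & b k z]) /\
    (forall i, b i z -> exists2 k, P k & b k `<=` b i).
Proof.
move=> [_ complete] Pi0 dense rules.
pose E (t : K + rule_idx r) i := match t with
  | inl t => D t i
  | inr j => (exists2 l, concl r j l & b i `<=` b l) \/
      (forall k, P k -> b k `<=` b i ->
         ~ b k `<=` b (prem1 r j) `&` b (prem2 r j)) end.
have Edense t i : P i -> exists k, [/\ P k, b k `<=` b i & E t k].
  case: t => [t|j] Pi; first exact: dense.
  have [[k [Pk ki kp]]|no] := pselect (exists k, [/\ P k, b k `<=` b i &
      b k `<=` b (prem1 r j) `&` b (prem2 r j)]).
    have [k' [Pk' k'k kq]] := rules j k Pk kp.
    by exists k'; split; [|exact: subset_trans ki|left].
  exists i; split=> //; right=> k Pk ki kp; apply: no; exists k; split=> //.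
have [c [cP cS cE]] := generic_chain Pi0 Edense.
have [||j [m1 c1] [m2 c2]|z zP] := complete [set i | exists n, b (c n) `<=` b i].
- by exists (c 0%N), 0%N.
- by move=> i j ij [n ni]; exists n; apply: subset_trans ij.
- have [n [[l ql nl]|no]] := cE (inr j); first by exists l => //; exists n.
  (* Since both premises belong to the filter, a late term of the chain lies in both of them,
     against [no]. *)
  have := no (c (maxn n (maxn m1 m2))) (cP _) (cS _ _ (leq_maxl _ _)).
  case=> x xc; split; [apply: c1|apply: c2]; apply: cS xc.
    by rewrite !leq_max leqnn !orbT.
  by rewrite !leq_max leqnn !orbT.
exists z; split=> [t|i /zP[n ni]]; last by exists (c n).
by have [n En] := cE (inl t); exists (c n); split=> //; apply/zP; exists n.
Qed.

End Presentations.

(** * Quasi-metrics from covering rules *)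

(** The distance is 1/(m+1) for the first [m] at which [P m x y] fails, and 0 if there is none.
    Transitivity of each [P n] yields the triangle inequality, even in ultrametric form. *)
Lemma first_failure_quasi_metric (R : realType) (X : Type)
    (P : nat -> X -> X -> Prop) :
  (forall n x, P n x x) ->
  (forall n x y z, P n x y -> P n y z -> P n x z) ->
  exists d : X -> X -> R, [/\ forall x y, (0 <= d x y)%R,
    forall x y z, (d x z <= d x y + d y z)%R &
    forall x y n, (d x y < n.+1%:R^-1)%R <->
      (forall k, (k <= n)%N -> P k x y)].
Proof.
move=> Pxx Ptr.
have /choice[d dP] : forall xy : X * X, exists r : R,
    ((r = 0 \/ exists n, r = n.+1%:R^-1) /\ forall n, r < n.+1%:R^-1 <->
      (forall k, (k <= n)%N -> P k xy.1 xy.2))%R.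
  move=> [x y] /=.
  have [exn|no] := pselect (exists n, `[< ~ P n x y >]).
    case: (ex_minnP exn) => m /asboolP nPm minm.
    exists (m.+1%:R^-1)%R; split; first by right; exists m.
    move=> n; rewrite ltf_pV2 ?posrE ?ltr0n// ltr_nat ltnS; split.
      move=> nm k kn; apply: contrapT => /asboolP/minm.
      by rewrite leqNgt (leq_ltn_trans kn nm).
    by move=> Pk; rewrite ltnNge; apply/negP => /Pk.
  exists 0%R; split; first by left.
  move=> n; rewrite invr_gt0 ltr0n; split=> // _ k _.
  by apply: contrapT => nP; apply: no; exists k; apply/asboolP.
exists (fun x y => d (x, y)); split=> [x y|x y z|x y n].
- by have [[->//|[n ->]] _] := dP (x, y); rewrite invr_ge0.
- have dge u v : (0 <= d (u, v))%R.
    by have [[->//|[n ->]] _] := dP (u, v); rewrite invr_ge0.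
  have [[->|[n dn]] dxz] := dP (x, z); first by rewrite addr_ge0.
  rewrite leNgt; apply/negP => lt.
  have xy : (d (x, y) < n.+1%:R^-1)%R.
    by rewrite -dn; apply: le_lt_trans lt; rewrite lerDl.
  have yz : (d (y, z) < n.+1%:R^-1)%R.
    by rewrite -dn; apply: le_lt_trans lt; rewrite lerDr.
  move: xy => /(dP _).2 xy; move: yz => /(dP _).2 yz.
  suff : (d (x, z) < n.+1%:R^-1)%R by rewrite dn ltxx.
  by apply/dxz => k kn; apply: Ptr (xy _ kn) (yz _ kn).
- exact: (dP (x, y)).2.
Qed.

Lemma exists_natSinv_lt (R : realType) (e : R) :
  (0 < e)%R -> exists n : nat, (n.+1%:R^-1 < e)%R.
Proof.
move=> e0; have [n _ /(_ n (leqnn n)) nP] := near_infty_natSinv_lt (PosNum e0).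
by exists n.
Qed.

Lemma eventually_all_lt (P : nat -> nat -> Prop) n :
  (forall i, (i <= n)%N -> exists N, forall m, (N <= m)%N -> P i m) ->
  exists N, forall i m, (i <= n)%N -> (N <= m)%N -> P i m.
Proof.
elim: n => [|n IH] H.
  have [N NP] := H 0%N (leqnn _); exists N => i m.
  by rewrite leqn0 => /eqP->; apply: NP.
have [i /leqW|N NP] := IH; first exact: H.
have [M MP] := H n.+1 (leqnn _); exists (maxn N M) => i m.
rewrite leq_eqVlt geq_max => /orP[/eqP->|iN] /andP[Nm Mm]; first exact: MP.
exact: NP.
Qed.

(** A Cauchy sequence converges to the point whose basic neighborhoods are the sets [b i] that
    eventually contain the sequence; completeness of the rules provides this point. *)
Lemma quasi_polish_base_topology (R : realType) (T : Type) (I : countType)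
    (b : I -> set T) :
  quasi_polish_base b -> quasi_polish_topology R (base_topology b).
Proof.
move=> [dirb sepb [[J p1 p2 q] [sound complete]]]; split.
  exists (range b); split.
  - exact: countable_image (countableP _).
  - by move=> _ [i _ <-]; apply: base_topology_base.
  - by rewrite base_topology_unionsE.
(* Trivial rules are added so that the sets b i themselves are controlled. *)
pose qq (r : I + J) : set I := match r with inl i => [set i] | inr j => q j end.
(* [rel n x y]: whenever an index in the conclusion of rule [n] is realized at [x], one that is no
   larger is realized at [y]. This bound is what lets the limit of a sequence obey the rules. *)
pose rel n x y := match @unpickle (I + J)%type n with
  | Some r => forall i, qq r i -> b i x ->
      exists i', [/\ qq r i', (pickle i' <= pickle i)%N & b i' y]
  | None => True end.
have rel_rule r x y : rel (pickle r) x y -> forall i, qq r i -> b i x ->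
    exists i', [/\ qq r i', (pickle i' <= pickle i)%N & b i' y].
  by rewrite /rel pickleK.
have relxx n x : rel n x x.
  by rewrite /rel; case: unpickle => // r i qi bi; exists i.
have reltr n x y z : rel n x y -> rel n y z -> rel n x z.
  rewrite /rel; case: unpickle => // r xy yz i qi bi.
  have [i' [qi' le' bi']] := xy _ qi bi.
  have [k [qk lek bk]] := yz _ qi' bi'.
  by exists k; split=> //; apply: leq_trans le'.
(* the least index of a rule satisfied at x witnesses all of [rel n x] *)
have relnbhs n x : exists2 i, b i x & forall y, b i y -> rel n x y.
  rewrite /rel; case: (unpickle n) => [r|]; last first.
    by have [[i bi] _] := dirb; exists i; rewrite ?bi.
  have [exi|no] := pselect (exists m, `[< exists i, [/\ qq r i, b i x &
      pickle i = m] >]); last first.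
    have [[i0 bi0] _] := dirb; exists i0; first by rewrite bi0.
    move=> y _ i qi bi; exfalso; apply: no; exists (pickle i).
    by apply/asboolP; exists i.
  case: (ex_minnP exi) => m /asboolP[i [qi bi im]] minm.
  exists i => // y iy k qk bk; exists i; split=> //.
  by rewrite im; apply: minm; apply/asboolP; exists k.
have [d [d0 dtri dlt]] := first_failure_quasi_metric R relxx reltr.
have dxx x : d x x = 0%R.
  apply/eqP; rewrite eq_le d0 andbT leNgt; apply/negP => /exists_natSinv_lt[n].
  by rewrite ltNge => /negP; apply; apply/ltW/dlt => k _.
exists d; split.
- split=> // x y; split=> [[xy yx]|->//]; apply: sepb => i.
  have sub u v : d u v = 0%R -> b i u -> b i v.
    move=> duv bu.
    have /rel_rule/(_ i) : rel (pickle (inl i : I + J)) u v.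
      apply: (dlt u v _).1 (leqnn _).
      by rewrite duv invr_gt0 ltr0n.
    by move=> /(_ erefl bu)[i' [-> _]].
  by split; apply: sub.
- move=> u cu.
  have relc n : exists N, forall k m, (N <= k <= m)%N -> rel n (u k) (u m).
    have [|N NP] := cu (n.+1%:R^-1)%R; first by rewrite invr_gt0 ltr0n.
    by exists N => k m /NP/dlt; apply.
  pose s := [set i | exists N, forall n, (N <= n)%N -> b i (u n)].
  have evN i : ~ s i -> exists N, forall n, (N <= n)%N -> ~ b i (u n).
    move=> nsi; have [N NP] := relc (pickle (inl i : I + J)).
    exists N => n Nn bi; apply: nsi; exists n => m nm.
    have /rel_rule : rel (pickle (inl i : I + J)) (u n) (u m).
      by apply: NP; rewrite Nn.
    by move=> /(_ i erefl bi)[i' [-> _]].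
  (* Along the sequence some index up to [pickle i] keeps being realized. If none of these finitely
     many candidates were in [s], one late term would avoid them all. *)
  have pigeon r : exists N, forall n i, (N <= n)%N -> qq r i -> b i (u n) ->
      exists i', [/\ qq r i', (pickle i' <= pickle i)%N & s i'].
    have [N NP] := relc (pickle r); exists N => n i Nn qi bi.
    apply: contrapT => no.
    pose P k m := forall i', qq r i' -> pickle i' = k -> ~ b i' (u m).
    have [k ki|M MP] := @eventually_all_lt P (pickle i).
      have [[i' [qi' i'k]]|none] := pselect (exists i', qq r i' /\ pickle i' = k).
        have [|M MP] := evN i'.
          by move=> si'; apply: no; exists i'; rewrite i'k.
        exists M => m /MP nb i2 _ i2k.
        by rewrite -(pcan_inj pickleK (etrans i'k (esym i2k))).
      by exists 0%N => m _ i' qi' i'k; case: none; exists i'.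
    have /rel_rule : rel (pickle r) (u n) (u (maxn n M)).
      by apply: NP; rewrite Nn leq_maxl.
    move=> /(_ _ qi bi)[i' [qi' le' bi']].
    exact: (MP _ (maxn n M) le' (leq_maxr _ _) i' qi' erefl).
  have [||j [N1 s1] [N2 s2]|x xP] := complete s.
  - by have [[i bi] _] := dirb; exists i, 0%N => n _; rewrite bi.
  - by move=> i j ij [N NP]; exists N => n /NP/ij.
  - have [N NP] := pigeon (inr j).
    pose M := maxn N (maxn N1 N2).
    have [||i qi bi] := sound (u M) j.
      by apply: s1; rewrite !leq_max leqnn orbT.
      by apply: s2; rewrite !leq_max leqnn !orbT.
    have [i' [qi' _ si']] := NP M i (leq_maxl _ _) qi bi.
    by exists i'.
  have ev n : exists N, forall m, (N <= m)%N -> rel n x (u m) /\ rel n (u m) x.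
    have [i bix iP] := relnbhs n x.
    have [N1 N1P] := (xP i).2 bix.
    have [N2 N2P] : exists N, forall m, (N <= m)%N -> rel n (u m) x.
      rewrite /rel; case: unpickle => [r|]; last by exists 0%N.
      have [N NP] := pigeon r; exists N => m Nm k qk bk.
      by have [i' [? ? /xP ?]] := NP _ _ Nm qk bk; exists i'.
    exists (maxn N1 N2) => m; rewrite geq_max => /andP[m1 m2].
    by split; [apply/iP/N1P|apply: N2P].
  exists x => e /exists_natSinv_lt[n ne].
  have [N NP] := eventually_all_lt (fun i _ => ev i) (n := n).
  exists N => m Nm; rewrite gt_max; apply/andP; split.
    by apply: lt_trans ne; apply/dlt => k kn; have [] := NP k m kn Nm.
  by apply: lt_trans ne; apply/dlt => k kn; have [] := NP k m kn Nm.
- apply/seteqP; split=> A oA x Ax.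
    have [i bix bA] := oA x Ax.
    exists ((pickle (inl i : I + J)).+1%:R^-1)%R; first by rewrite invr_gt0 ltr0n.
    move=> y /= /dlt/(_ _ (leqnn _))/rel_rule/(_ i erefl bix)[i' [-> _]].
    exact: bA.
  have [e e0 eA] := oA x Ax; have [n ne] := exists_natSinv_lt e0.
  suff [i bix iP] : exists2 i, b i x &
      forall y, b i y -> forall k, (k <= n)%N -> rel k x y.
    exists i => // y /iP yP; apply: eA => /=; apply: lt_trans ne.
    exact/dlt.
  elim: n {ne} => [|n [i bix iP]].
    have [i bix iP] := relnbhs 0%N x; exists i => // y iy k.
    by rewrite leqn0 => /eqP->; apply: iP.
  have [i' bi'x i'P] := relnbhs n.+1 x.
  have [k bkx kS] := dirb.2 _ _ _ bix bi'x; exists k => // y /kS[iy i'y] m.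
  by rewrite leq_eqVlt => /orP[/eqP->|]; [apply: i'P|apply: iP].
Qed.

(** * Constructions on presented bases *)

(** The default [x0] is always a value, so [D] may be empty; with [setT] as default, an enumerated
    base also acquires the whole space. *)
Lemma countable_enum (T : Type) (D : set T) (x0 : T) : countable D ->
  exists e : nat -> T, [/\ forall n, D (e n) \/ e n = x0, exists n, e n = x0 &
    forall x, D x -> exists n, e n = x].
Proof.
move=> /countable_injP[f finj].
have /choice[g gP] : forall n, exists y, (D y /\ f y = n) \/
    (y = x0 /\ forall x, D x -> f x <> n).
  move=> n; have [[y yP]|no] := pselect (exists y, D y /\ f y = n).
    by exists y; left.
  by exists x0; right; split=> // x Dx fx; apply: no; exists x.
exists (fun n => if n is m.+1 then g m else x0); split.
- by case=> [|n]; [right|have [[]|[]] := gP n; [left|right]].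
- by exists 0%N.
- move=> x Dx; exists (f x).+1; have [[Dg fg]|[_ /(_ x Dx)]//] := gP (f x).
  by apply: finj; rewrite ?inE.
Qed.

(** Each rule covers [b i] intersected with [b k] by sets of a prescribed smallness that lie well
    inside [b i]. A system obeying these rules contains a shrinking sequence whose centers form a
    Cauchy sequence, and the limit realizes the system. *)
Lemma quasi_polish_has_base (R : realType) (T : Type) (O : set_system T) :
  quasi_polish_topology R O ->
  exists2 b : nat -> set T, quasi_polish_base b & O = base_topology b.
Proof.
move=> [[D [cD DO OD]] [d [[d0 dsep dtri] dcomp OE]]].
have dxx x : d x x = 0%R by have [] := (dsep x x).2 erefl.
have [b [bD [top btop] Db]] := countable_enum setT cD.
have bO i : O (b i).
  have [/DO//|->] := bD i; rewrite OE => x _; exists 1%R => //.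
have bball i x : b i x -> exists2 e : R, (0 < e)%R &
    forall y, (d x y < e)%R -> b i y.
  by have := bO i; rewrite OE => /(_ x) H /H[e e0 eP]; exists e.
have ballb A x : O A -> A x -> exists2 i, b i x & b i `<=` A.
  move=> /OD[D' D'D ->] [B D'B Bx]; have [i bi] := Db _ (D'D _ D'B).
  by exists i; rewrite bi// => y By; exists B.
have oball x (e : R) : O [set y | (d x y < e)%R].
  rewrite OE => y /= xy; exists (e - d x y)%R; first by rewrite subr_gt0.
  by move=> z /= yz; apply: le_lt_trans (dtri x y z) _; lra.
have small x (e : R) : (0 < e)%R ->
    exists2 i, b i x & forall y, b i y -> (d x y < e)%R.
  by move=> e0; apply: (ballb _ x (oball x e)) => /=; rewrite dxx.
have oI A B : O A -> O B -> O (A `&` B).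
  rewrite OE => oA oB x [Ax Bx].
  have [e e0 eA] := oA _ Ax; have [f f0 fB] := oB _ Bx.
  exists (Num.min e f); first by rewrite lt_min e0.
  by move=> y /=; rewrite lt_min => /andP[/eA ? /fB ?].
have OEb : O = base_topology b.
  apply/seteqP; split=> A; first by move=> OA x; apply: ballb.
  move=> bA; rewrite OE => x /bA[i bix iA]; have [e e0 eP] := bball _ _ bix.
  by exists e => // y /eP/iA.
exists b => //; split.
- split; first by exists top.
  by move=> i j x ix jx; apply: ballb; [apply: oI|split].
- move=> x y xy; apply/dsep.
  have sub u v : (forall i, b i u -> b i v) -> d u v = 0%R.
    move=> uv; apply/eqP; rewrite eq_le d0 andbT leNgt; apply/negP => duv.
    have [i bu iP] := small u _ duv.
    by have := iP _ (uv _ bu); rewrite ltxx.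
  by split; apply: sub => i /xy.
(* The first condition gives [b j] a center from which all its points are closer than 1/(n+1); the
   second puts a uniform enlargement of [b j] inside [b i]. *)
pose strong n j i := (exists2 y, b j y &
    forall z, b j z -> (d y z < n.+1%:R^-1)%R) /\
  exists2 e : R, (0 < e)%R & forall w z, b j w -> (d w z < e)%R -> b i z.
have strongS n j i : strong n j i -> b j `<=` b i.
  by move=> [_ [e e0 eP]] x bx; apply: eP bx _; rewrite dxx.
exists (@Rules nat (nat * nat * nat)%type (fun r => r.1.1) (fun r => r.1.2)
  (fun r => [set j | b j `<=` b r.1.2 /\ strong r.2 j r.1.1])); split.
  move=> x [[i k] n] /= ix kx; have [e e0 eP] := bball _ _ ix.
  rewrite /strong; set a := (n.+1%:R^-1)%R.
  pose f := Num.min (a / 2)%R (e / 2)%R.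
  have a0 : (0 < a)%R by rewrite invr_gt0 ltr0n.
  have f0 : (0 < f)%R by rewrite lt_min !divr_gt0.
  have [j jx jf] := small x f f0.
  have [l lx lS] : exists2 l, b l x & b l `<=` b j `&` b k.
    by apply: ballb; [apply: oI|].
  exists l => //; split; first by move=> y /lS[].
  split; first exists x => // z /lS[/jf + _].
    by rewrite lt_min => /andP[+ _]; lra.
  exists (e / 2)%R; first by lra.
  move=> w z /lS[/jf + _]; rewrite lt_min => /andP[_ xw] wz; apply: eP.
  by apply: le_lt_trans (dtri x w z) _; lra.
move=> s [i0 si0] sup srule.
(* Step [n] shrinks the current set at scale [n] and also enters [b n] if [n] is in [s], so the
   sequence gets below every set of the system. *)
have /choice[F FP] : forall ni : nat * nat, exists j, s ni.2 ->
    [/\ s j, strong ni.1 j ni.2 & s ni.1 -> b j `<=` b ni.1].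
  move=> [n i] /=; have [si|nsi] := pselect (s i); last by exists i.
  have [sn|nsn] := pselect (s n).
    by have [j [/= jn st] sj] := srule (i, n, n) si sn; exists j.
  by have [j [/= jn st] sj] := srule (i, i, n) si si; exists j.
pose c := fix c n := if n is m.+1 then F (m, c m) else i0.
have cs n : s (c n) by elim: n => //= n IH; have [] := FP (n, c n) IH.
have cF n := FP (n, c n) (cs n).
have cS m n : (m <= n)%N -> b (c n) `<=` b (c m).
  elim: n => [|n IH]; first by rewrite leqn0 => /eqP->.
  rewrite leq_eqVlt => /orP[/eqP->//|/IH]; apply: subset_trans.
  by have [_ /strongS] := cF n.
have /choice[y yP] : forall n, exists y, b (c n.+1) y /\
    forall z, b (c n.+1) z -> (d y z < n.+1%:R^-1)%R.
  by move=> n; have [_ [[y ? ?] _] _] := cF n; exists y.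
have [e e0|l lP] := dcomp y.
  have [N Ne] := exists_natSinv_lt e0; exists N => n m /andP[Nn nm].
  have : (d (y n) (y m) < n.+1%:R^-1)%R.
    by apply: (yP n).2; apply: (cS n.+1 m.+1 nm); apply: (yP m).1.
  move=> /lt_le_trans; apply; apply: le_trans (ltW Ne).
  by rewrite lef_pV2 ?posrE ?ltr0n// ler_nat ltnS.
exists l => i; split.
  (* The late centers lie in [b (c i.+2)], and the uniform margin of [strong] carries their limit
     into [b (c i.+1)], hence into [b i]. *)
  move=> si; have [_ _ /(_ si) ci] := cF i.
  have [_ [_ [e e0 eP]] _] := cF i.+1.
  have [N NP] := lP e e0; apply: ci.
  pose n := maxn N i.+1; have := NP n (leq_maxl _ _).
  rewrite gt_max => /andP[_ nl]; apply: eP nl.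
  by apply: (cS i.+2 n.+1); [rewrite ltnS leq_maxr|exact: (yP n).1].
(* Conversely, a ball around [l] inside [b i] swallows [b (c n.+1)] for large [n], and [s] is upward
   closed. *)
move=> li; have [e e0 eP] := bball _ _ li.
have e20 : (0 < e / 2)%R by lra.
have [N NP] := lP _ e20; have [M Me] := exists_natSinv_lt e20.
pose n := maxn N M; apply: sup (cs n.+1) => z nz; apply: eP.
apply: le_lt_trans (dtri l (y n) z) _.
have := NP n (leq_maxl _ _); rewrite gt_max => /andP[ln _].
set a := (M.+1%:R^-1)%R in Me *.
have : (d (y n) z < a)%R.
  apply: lt_le_trans ((yP n).2 _ nz) _.
  by rewrite lef_pV2 ?posrE ?ltr0n// ler_nat ltnS leq_maxr.
by lra.
Qed.

(** Besides the rules of each level, there are rules covering [b m i] by sets of level [m.+1]. A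
    system obeying them all is realized by a point at each level, and the additional rules force
    consecutive points to coincide. *)
Lemma quasi_polish_base_join (T : Type) (b : nat -> nat -> set T) :
  (forall m, quasi_polish_base (b m)) ->
  (forall m i, base_topology (b m.+1) (b m i)) ->
  quasi_polish_base (fun mi : nat * nat => b mi.1 mi.2).
Proof.
move=> qpb inc.
have incle m n i : (m <= n)%N -> base_topology (b n) (b m i).
  move=> /subnKC <-; elim: (n - m)%N => [|k IH].
    by rewrite addn0; apply: base_topology_base.
  rewrite addnS => x /IH[j jx jS]; have [l lx lS] := inc _ _ _ jx.
  by exists l => //; apply: subset_trans jS.
split.
- split; first by have [[[i bi] _] _ _] := qpb 0%N; exists (0%N, i).
  move=> [m i] [n j] x /= ix jx.
  have [[_ dir] _ _] := qpb (maxn m n).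
  have [k kx ki] := incle _ _ i (leq_maxl m n) _ ix.
  have [l lx lj] := incle _ _ j (leq_maxr m n) _ jx.
  have [h hx hS] := dir _ _ _ kx lx; exists (maxn m n, h) => // y /hS[/ki ? /lj ?].
  by split.
- move=> x y xy; have [_ sep _] := qpb 0%N; apply: sep => i.
  exact: (xy (0%N, i)).
have /choice[r rP] : forall m, exists r, presents (b m) r.
  by move=> m; have [] := qpb m.
pose J := ({m : nat & rule_idx (r m)} + nat * nat)%type.
pose p (pr : forall m, rule_idx (r m) -> nat) (j : J) := match j with
  | inl (existT m j) => (m, pr m j)
  | inr mi => mi end.
pose q (j : J) : set (nat * nat) := match j with
  | inl (existT m j) => [set mi | mi.1 = m /\ concl (r m) j mi.2]
  | inr (m, i) => [set nk | nk.1 = m.+1 /\ b m.+1 nk.2 `<=` b m i] end.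
exists (@Rules (nat * nat) J (p (fun m => prem1 (r m)))
  (p (fun m => prem2 (r m))) q); split.
  move=> x [[m j]|[m i]] /= x1 x2.
    by have [i qi ix] := (rP m).1 x j x1 x2; exists (m, i).
  by have [k kx ki] := inc _ _ _ x1; exists (m.+1, k).
move=> s [[m0 i0] s0] sup srule.
have /choice[x xP] : forall m, exists x, forall i, s (m, i) <-> b m i x.
  move=> m; apply: ((rP m).2 [set i | s (m, i)]).
  - have [[[t bt] _] _ _] := qpb m; exists t => /=.
    by apply: sup s0; rewrite /= bt.
  - by move=> i j ij; apply: sup.
  - move=> j s1 s2; have [[m' i] /= [-> qi] si] := srule (inl (existT _ m j)) s1 s2.
    by exists i.
have xS m : x m.+1 = x m.
  have [_ sep _] := qpb m; apply: sep => i; split.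
    move=> /inc[k /xP sk ki]; apply/xP; exact: sup sk.
  move=> /xP si; have [[m' k] /= [-> ki] sk] := srule (inr (m, i)) si si.
  exact/ki/xP.
have xE m : x m = x 0%N by elim: m => // m <-.
by exists (x 0%N) => -[m i] /=; rewrite -(xE m).
Qed.

(** The rules of each factor are used with the whole space as the other side; a third kind of rule
    recombines the strips over [b i] and [c k] into their rectangle. *)
Lemma quasi_polish_base_prod (T U : Type) (I K : countType) (b : I -> set T)
    (c : K -> set U) :
  quasi_polish_base b -> quasi_polish_base c ->
  quasi_polish_base (fun ik : I * K => b ik.1 `*` c ik.2).
Proof.
move=> [[[tb btop] dirb] sepb [r rP]] [[[tc ctop] dirc] sepc [r' r'P]].
split.
- split; first by exists (tb, tc); rewrite /= btop ctop -setXTT.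
  move=> [i k] [j l] [x y] /= [ix ky] [jx ly].
  have [m mx mS] := dirb _ _ _ ix jx; have [n ny nS] := dirc _ _ _ ky ly.
  by exists (m, n) => // -[u v] [/= /mS[? ?] /nS[? ?]].
- move=> [x y] [x' y'] same; congr pair.
    by apply: sepb => i; have := same (i, tc); rewrite /= ctop /setX/=; tauto.
  by apply: sepc => k; have := same (tb, k); rewrite /= btop /setX/=; tauto.
pose J := (rule_idx r + rule_idx r' + I * K)%type.
pose p (pr : rule_idx r -> I) (pr' : rule_idx r' -> K) h (j : J) :=
  match j with
  | inl (inl j) => (pr j, tc)
  | inl (inr j) => (tb, pr' j)
  | inr ik => h ik end.
pose q (j : J) : set (I * K) := match j with
  | inl (inl j) => [set ik | concl r j ik.1 /\ ik.2 = tc]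
  | inl (inr j) => [set ik | ik.1 = tb /\ concl r' j ik.2]
  | inr ik => [set ik] end.
exists (@Rules (I * K)%type J
  (p (prem1 r) (prem1 r') (fun ik => (ik.1, tc)))
  (p (prem2 r) (prem2 r') (fun ik => (tb, ik.2))) q).
split.
  move=> [x y] [[j|j]|[i k]] /= [/= x1 y1] [/= x2 y2].
  - by have [i qi ix] := rP.1 x j x1 x2; exists (i, tc).
  - by have [k qk ky] := r'P.1 y j y1 y2; exists (tb, k).
  - by exists (i, k).
move=> s [[i0 k0] s0] sup srule.
have sl i k : s (i, k) -> s (i, tc).
  by apply: sup => -[u v] [/= ? ?]; split=> //=; rewrite ctop.
have sr i k : s (i, k) -> s (tb, k).
  by apply: sup => -[u v] [/= ? ?]; split=> //=; rewrite btop.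
have [|||x xP] := rP.2 [set i | s (i, tc)].
- by exists i0; apply: sl s0.
- by move=> i j ij; apply: sup => -[u v] [/= /ij].
- move=> j s1 s2; have [[i k] /= [qi ->] si] := srule (inl (inl j)) s1 s2.
  by exists i.
have [|||y yP] := r'P.2 [set k | s (tb, k)].
- by exists k0; apply: sr s0.
- by move=> i j ij; apply: sup => -[u v] [/= ? /ij].
- move=> j s1 s2; have [[i k] /= [-> qi] si] := srule (inl (inr j)) s1 s2.
  by exists k.
exists (x, y) => -[i k] /=; split.
  by move=> sik; split; [apply/xP/(sl _ _ sik)|apply/yP/(sr _ _ sik)].
move=> [/xP s1 /yP s2].
by have [_ -> //] := srule (inr (i, k)) s1 s2.
Qed.

(* [E i] stands for the set of points whose f-fiber meets [b i] in a large set,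
   for fiberwise notions of largeness given by sigma-ideals. *)
Lemma quasi_polish_base_pushforward (Z X : Type) (I : countType)
    (b : I -> set Z) (f : Z -> X) (E : I -> set X) :
  quasi_polish_base b ->
  (forall i, b i = setT -> E i = setT) ->
  (forall i x (q : set I), E i x ->
     (forall z, b i z -> f z = x -> exists2 k, q k & b k z) ->
     exists2 k, q k & E k x) ->
  (forall i, base_topology b (f @^-1` E i)) ->
  separating E -> quasi_polish_base E.
Proof.
move=> [[[top btop] dirb] _ [r rP]] ET Ecover Eopen sepE.
have Eimage i x : E i x -> exists2 z, b i z & f z = x.
  move=> Eix; apply: contrapT => no.
  have [z bz fz|k []] := Ecover i x set0 Eix.
  by case: no; exists z.
have Esub i (q : set I) : (forall z, b i z -> exists2 k, q k & b k z) ->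
    forall x, E i x -> exists2 k, q k & E k x.
  by move=> iq x Ex; apply: Ecover Ex _ => z /iq.
have Emono i k : b i `<=` b k -> E i `<=` E k.
  move=> ik x /(@Esub i [set k])[z iz|_ -> //].
  by exists k => //; apply: ik.
have Epre i k : b i `<=` f @^-1` E k -> E i `<=` E k.
  by move=> ik x /Eimage[z /ik Ekz <-].
have Erefine i k x : E i x -> E k x ->
    exists2 l, b l `<=` b i `&` f @^-1` E k & E l x.
  move=> ix kx; apply: (Ecover i x [set l | b l `<=` b i `&` f @^-1` E k]) => //.
  move=> z iz fz; have [l lz lk] : exists2 l, b l z & b l `<=` f @^-1` E k.
    by apply: Eopen; rewrite /preimage/= fz.
  have [h hz hS] := dirb _ _ _ iz lz; exists h => // w /hS[? /lk ?].
  by split.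
split=> //.
- split; first by exists top; apply: ET.
  move=> i k x ix kx; have [l lS lx] := Erefine i k x ix kx.
  exists l => // y ly; split; first by apply: (Emono l) ly => z /lS[].
  by apply: (Epre l) ly => z /lS[].
pose J := (I * I + I * rule_idx r)%type.
(* The first kind of rule refines [b i] into the preimage of [E k]. The second transfers rule [j] of
   [Z] below [b i]; when [b i] does not lie inside both premises, every index is allowed. *)
pose q (j : J) : set I := match j with
  | inl (i, k) => [set l | b l `<=` b i `&` f @^-1` E k]
  | inr (i, j) => [set l | b i `<=` b (prem1 r j) `&` b (prem2 r j) ->
      b l `<=` b i /\ exists2 k, concl r j k & b l `<=` b k] end.
exists (@Rules I J
  (fun j => match j with inl (i, k) => i | inr (i, j) => i end)
  (fun j => match j with inl (i, k) => k | inr (i, j) => i end) q).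
split.
  move=> x [[i k]|[i j]] /=; first exact: Erefine.
  move=> ix _; apply: (Esub i) ix => z iz.
  have [ip|nip] := pselect (b i `<=` b (prem1 r j) `&` b (prem2 r j)); last first.
    by exists i.
  have [z1 z2] := ip _ iz; have [k qk kz] := rP.1 z j z1 z2.
  have [l lz lS] := dirb _ _ _ iz kz; exists l => // _.
  by split; [|exists k => //]; move=> w /lS[].
move=> s [i0 s0] sup srule.
(* Meeting requirement [k] puts the image of the generic point into [E k] as soon as [k] is in
   [s]. *)
pose D (k i : I) := s k -> b i `<=` f @^-1` E k.
have [k i si|j i si ip|z [zD zP]] := @generic_point _ _ b I s D i0 r rP s0.
- have [sk|nsk] := pselect (s k); last by exists i; split=> // /nsk.
  have [l lS sl] := srule (inl (i, k)) si sk; exists l; split=> //.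
    by move=> z /lS[].
  by move=> _ z /lS[].
- have [l /(_ ip)[li lk] sl] := srule (inr (i, j)) si si.
  by exists l.
exists (f z) => i; split.
  by move=> si; have [k [sk /(_ si) kD kz]] := zD i; apply: kD.
move=> /Eopen[k kz kE]; have [l sl lk] := zP k kz.
by apply: (sup l) => //; apply: Epre; apply: subset_trans kE.
Qed.

(** * Baire category *)

Section Category.
Variable T : topologicalType.
Implicit Types A B U V : set T.

Lemma nowhere_denseP A : nowhere_dense A <->
  forall U, open U -> U !=set0 ->
    exists V, [/\ open V, V !=set0, V `<=` U & V `&` A = set0].
Proof.
split=> [ndA U oU [x Ux]|H].
  exists (U `&` ~` closure A); split.
  - by apply: openI => //; apply: closed_openC; apply: closed_closure.
  - apply: contrapT => no.
    suff /(_ x Ux) : U `<=` (closure A)° by rewrite ndA.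
    rewrite -open_subsetE// => y Uy.
    by apply: contrapT => nAy; apply: no; exists y.
  - by move=> z [].
  - by rewrite -subset0 => z [[_ nA] Az]; apply/nA/subset_closure.
rewrite /nowhere_dense -subset0 => x Ax.
have [|V [oV [y Vy] VS VA]] := H _ (open_interior (closure A)); first by exists x.
have /interior_subset/(_ V) := VS _ Vy.
move=> /(_ (open_nbhs_nbhs (conj oV Vy)))[z [Az Vz]].
by have : (V `&` A) z by []; rewrite VA.
Qed.

Lemma nowhere_dense_sub A B : A `<=` B -> nowhere_dense B -> nowhere_dense A.
Proof.
move=> AB /nowhere_denseP H; apply/nowhere_denseP => U oU U0.
have [V [oV V0 VU VB]] := H U oU U0; exists V; split=> //.
by rewrite -subset0 -VB; apply: setIS.
Qed.

Lemma meager_sub A B : A `<=` B -> meager B -> meager A.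
Proof.
move=> AB [F ndF BF]; exists (fun n => F n `&` A).
  by move=> n; apply: nowhere_dense_sub (ndF n); apply: subIsetl.
by rewrite -setI_bigcupl -BF; apply/esym/setIidr.
Qed.

Lemma nowhere_dense_meager A : nowhere_dense A -> meager A.
Proof.
move=> ndA; exists (fun=> A) => //; apply/seteqP; split=> x; first by exists 0%N.
by move=> [].
Qed.

Lemma nowhere_dense0 : nowhere_dense (@set0 T).
Proof. by rewrite /nowhere_dense closure0 interior0. Qed.

Lemma meager_bigcup (I : countType) (q : set I) (B : I -> set T) :
  (forall i, q i -> meager (B i)) -> meager (\bigcup_(i in q) B i).
Proof.
move=> mB.
have /choice[F FP] : forall i, exists F : nat -> set T,
    (forall n, nowhere_dense (F n)) /\ (q i -> B i = \bigcup_n F n).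
  move=> i; have [/mB[F ndF BF]|nq] := pselect (q i); first by exists F.
  by exists (fun=> set0); split=> // _; apply: nowhere_dense0.
exists (fun n => if @unpickle (I * nat)%type n is Some (i, m) then
    (if `[< q i >] then F i m else set0) else set0).
  move=> n; case: unpickle => [[i m]|]; last exact: nowhere_dense0.
  by case: asboolP => _; [apply: (FP i).1|apply: nowhere_dense0].
apply/seteqP; split=> x.
  move=> [i qi]; rewrite ((FP i).2 qi) => -[m _ Fx].
  by exists (pickle (i, m)) => //; rewrite pickleK asboolT.
move=> [n _]; case: unpickle => [[i m]|//]; case: asboolP => // qi Fx.
by exists i => //; rewrite ((FP i).2 qi); exists m.
Qed.

Lemma meagerU A B : meager A -> meager B -> meager (A `|` B).
Proof.
move=> mA mB; apply: (@meager_sub _ (\bigcup_(i in [set: bool]) if i then A else B)).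
  by move=> x [Ax|Bx]; [exists true|exists false].
by apply: meager_bigcup => -[].
Qed.

Lemma nonmeager_cover (I : countType) (q : set I) (B : I -> set T) A :
  ~ meager A -> A `<=` \bigcup_(i in q) B i -> exists2 i, q i & ~ meager (B i).
Proof.
move=> nA AB; apply: contrapT => no; apply: nA; apply: meager_sub AB _.
by apply: meager_bigcup => i qi; apply: contrapT => nB; apply: no; exists i.
Qed.

Lemma open_frontier_nowhere_dense V :
  open V -> nowhere_dense (closure V `\` V).
Proof.
move=> oV; apply/nowhere_denseP => U oU [x Ux].
have [[y [Uy Vy]]|no] := pselect ((U `&` V) !=set0).
  exists (U `&` V); split; [exact: openI|by exists y|exact: subIsetl|].
  by rewrite -subset0 => z [[_ Vz] []].
exists U; split=> //; first by exists x.
rewrite -subset0 => z [Uz [Vz _]]; apply: no.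
have [y [Vy Uy]] := Vz U (open_nbhs_nbhs (conj oU Uz)).
by exists y.
Qed.

Definition baire_property A : Prop :=
  exists2 V, open V & meager ((A `\` V) `|` (V `\` A)).

(** The sets with the Baire property form a sigma-algebra. For a complement, [V] is replaced by its
    exterior, at the cost of the frontier of [V], which is nowhere dense. *)
Lemma borel_baire_property A : borel T A -> baire_property A.
Proof.
move: A; apply: smallest_sub; last first.
  move=> V oV; exists V => //; rewrite setDv setUid.
  exact/nowhere_dense_meager/nowhere_dense0.
split.
- exists set0; first exact: open0.
  rewrite setDv setUid; exact/nowhere_dense_meager/nowhere_dense0.
- move=> A [V oV mA]; exists (~` closure V).
    by apply: closed_openC; apply: closed_closure.
  apply: (meager_sub _ (meagerU mA
    (nowhere_dense_meager (open_frontier_nowhere_dense oV)))).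
  move=> x [[[_ nA] ncV]|[ncV nA]].
    move: ncV => /contrapT cV.
    have [Vx|nVx] := pselect (V x); [left; right|right]; by split.
  have Ax : A x by apply: contrapT => nAx; apply: nA.
  by left; left; split=> // /subset_closure.
- move=> A bA; have /choice[V VP] : forall n, exists V, open V /\
      meager ((A n `\` V) `|` (V `\` A n)).
    by move=> n; have [V] := bA n; exists V.
  exists (\bigcup_n V n); first by apply: bigcup_open => n _; have [] := VP n.
  apply: meager_sub (meager_bigcup (q := setT) (fun n _ => (VP n).2)).
  move=> x [[[n _ An] nV]|[[n _ Vn] nA]]; exists n => //.
    by left; split=> // Vn; apply: nV; exists n.
  by right; split=> // An; apply: nA; exists n.
Qed.

Lemma meager_homeo (f g : T -> T) A : cancel f g -> cancel g f ->
  (forall U, open U -> open (f @^-1` U)) ->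
  (forall U, open U -> open (g @^-1` U)) ->
  meager A -> meager (f @^-1` A).
Proof.
move=> fK gK cf cg [F ndF ->]; exists (fun n => f @^-1` F n); last first.
  by rewrite preimage_bigcup.
move=> n; apply/nowhere_denseP => U oU [x Ux].
have /nowhere_denseP/(_ _ (cg _ oU))[|V [oV [y Vy] VU VF]] := ndF n.
  by exists (f x); rewrite /preimage/= fK.
exists (f @^-1` V); split; first exact: cf.
- by exists (g y); rewrite /preimage/= gK.
- by move=> z /VU; rewrite /preimage/= fK.
- by rewrite -preimage_setI VF preimage_set0.
Qed.

(** [Q] is the exterior of the union [D] of all basic sets in which [A] is meager. Countability of
    the base makes [A] meager in [D], hence in its closure, while an open set in which [A] is meager
    is contained in [D]. *)
Lemma open_hull (u : nat -> set T) A : @open T = base_topology u ->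
  exists Q, [/\ open Q, meager (A `\` Q) &
    forall W, open W -> W !=set0 -> W `<=` Q -> ~ meager (A `&` W)].
Proof.
move=> openE.
have ou i : open (u i) by rewrite openE; apply: base_topology_base.
pose q := [set i | meager (A `&` u i)]; pose D := \bigcup_(i in q) u i.
have oD : open D by apply: bigcup_open => i _.
exists (~` closure D); split.
- by apply: closed_openC; apply: closed_closure.
- apply: (@meager_sub _ ((\bigcup_(i in q) (A `&` u i)) `|` (closure D `\` D))).
    move=> x [Ax /contrapT cD].
    have [[i qi ux]|nD] := pselect (D x); [by left; exists i|by right].
  apply: meagerU; first exact: meager_bigcup.
  exact/nowhere_dense_meager/open_frontier_nowhere_dense.
- move=> W oW [x Wx] WQ mA; have : base_topology u W by rewrite -openE.
  move=> /(_ x Wx)[i ux uW]; apply: (WQ x Wx); apply: subset_closure.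
  by exists i => //; apply: meager_sub mA; apply: setIS.
Qed.

(** The Baire category theorem: a generic sequence of nonempty basic sets gets disjoint from each
    [F n], so the point it defines lies in none of them. *)
Lemma quasi_polish_nonmeager (u : nat -> set T) (x : T) :
  @open T = base_topology u -> quasi_polish_base u -> ~ meager [set: T].
Proof.
move=> openE [[[top utop] diru] _ [r rP]] [F ndF TF].
have ou i : open (u i) by rewrite openE; apply: base_topology_base.
pose P i := u i !=set0; pose D n i := u i `&` F n = set0.
have [|n i Pi|j i [y iy] ip|z [zD _]] := @generic_point _ _ u nat P D top r rP.
- by exists x; rewrite utop.
- have /nowhere_denseP/(_ (u i) (ou i))[//|V [oV [y Vy] Vi VF]] := ndF n.
  move: oV; rewrite openE => /(_ y Vy)[k ky kV]; exists k; split.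
  + by exists y.
  + exact: subset_trans Vi.
  + by rewrite /D -subset0 -VF; apply: setSI.
- have [y1 y2] := ip _ iy; have [l ql ly] := rP.1 y j y1 y2.
  have [k ky kS] := diru _ _ _ iy ly; exists k; split; first by exists y.
    by move=> z /kS[].
  by exists l => // z /kS[].
have : [set: T] z by []; rewrite TF => -[n _ Fz].
by have [k [_ Dk kz]] := zD n; have : (u k `&` F n) z by []; rewrite Dk.
Qed.

End Category.

(** * Vaught transforms *)

Lemma countable_unions_bigcup (T : Type) (F : set_system T) (I : countType)
    (q : set I) (B : I -> set T) :
  (forall i, q i -> F (B i)) -> countable_unions F (\bigcup_(i in q) B i).
Proof.
move=> FB; exists (B @` q); split.
- exact: countable_image (countableP _).
- by move=> _ [i qi <-]; apply: FB.
- by rewrite bigcup_image.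
Qed.

Lemma countable_unions1 (T : Type) (F : set_system T) A :
  F A -> countable_unions F A.
Proof.
move=> FA; exists [set A]; split; last by rewrite bigcup_set1.
  exact: countable1.
by move=> _ ->.
Qed.

Lemma countable_unionsP (T : Type) (F : set_system T) A :
  countable_unions F A -> exists (q : set nat) (B : nat -> set T),
    (forall n, q n -> F (B n)) /\ A = \bigcup_(n in q) B n.
Proof.
move=> [D [cD DF ->]]; have [e [_ _ De]] := countable_enum set0 cD.
exists [set n | D (e n)], e; split; first by move=> n /DF.
apply/seteqP; split=> x; last by move=> [n Dn ex]; exists (e n).
by move=> [B DB Bx]; have [n en] := De _ DB; exists n; rewrite /= en.
Qed.

Lemma borel_preimage (T : topologicalType) (f : T -> T) A :
  (forall U, open U -> open (f @^-1` U)) -> borel T A -> borel T (f @^-1` A).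
Proof.
move=> cf; move: A; apply: smallest_sub; last first.
  by move=> U oU; apply: sub_sigma_algebra; apply: cf.
have [s0 sC sU] := @smallest_sigma_algebra T setT open.
split.
- by rewrite /= preimage_set0.
- by move=> A /= bA; rewrite setTD preimage_setC -setTD; apply: sC.
- by move=> A /= bA; rewrite preimage_bigcup; apply: sU.
Qed.

Lemma borelD (T : topologicalType) (A B : set T) :
  borel T A -> borel T B -> borel T (A `\` B).
Proof.
move=> bA bB; have [_ sC sU] := @smallest_sigma_algebra T setT open.
have -> : A `\` B = setT `\` \bigcup_n (if n is 0%N then setT `\` A else B).
  apply/seteqP; split=> x.
    by move=> [Ax nBx]; split=> // -[[|n] _] => [[]|].
  move=> [_ H]; split; last by move=> Bx; apply: H; exists 1%N.
  by apply: contrapT => nAx; apply: H; exists 0%N.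
by apply: (sC); apply: sU => -[|n] //; apply: sC.
Qed.

Section GroupAction.
Variables (G : topologicalGroupType) (X : Type) (alpha : G * X -> X).
Hypothesis act_alpha : is_action alpha.
Implicit Types (U V W : set G) (A B : set X).

Lemma actK (g : G) : cancel (fun x => alpha (g, x)) (fun x => alpha (g^-1%g, x)).
Proof. by move=> x; rewrite -act_alpha.2 mulVg act_alpha.1. Qed.

Lemma actVK (g : G) : cancel (fun x => alpha (g^-1%g, x)) (fun x => alpha (g, x)).
Proof. by move=> x; rewrite -act_alpha.2 mulgV act_alpha.1. Qed.

Lemma translateE (g : G) A : translate alpha g A = [set x | A (alpha (g^-1%g, x))].
Proof.
apply/seteqP; split=> x /=; first by move=> [y Ay <-]; rewrite actK.
by move=> Ax; exists (alpha (g^-1%g, x)) => //; rewrite actVK.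
Qed.

Lemma vaughtE U A :
  vaught alpha U A = [set x | ~ meager [set g | U g /\ A (alpha (g^-1%g, x))]].
Proof.
apply/seteqP; split=> x nm m; apply: nm; apply: meager_sub m => g [Ug Ag];
  by split=> //; move: Ag; rewrite translateE.
Qed.

Lemma vaught_cover (I : countType) (q : set I) (U_ : I -> set G)
    (A_ : I -> set X) U A x :
  vaught alpha U A x ->
  (forall g, U g -> A (alpha (g^-1%g, x)) ->
     exists2 i, q i & U_ i g /\ A_ i (alpha (g^-1%g, x))) ->
  exists2 i, q i & vaught alpha (U_ i) (A_ i) x.
Proof.
rewrite vaughtE => /nonmeager_cover nm cov.
have [i qi nmi] : exists2 i, q i &
    ~ meager [set g | U_ i g /\ A_ i (alpha (g^-1%g, x))].
  by apply: nm => g [Ug Ag]; have [i qi iP] := cov g Ug Ag; exists i.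
by exists i => //; rewrite vaughtE.
Qed.

Lemma vaught_sub U V A B : U `<=` V -> A `<=` B ->
  vaught alpha U A `<=` vaught alpha V B.
Proof.
move=> UV AB x; rewrite !vaughtE => nm m; apply: nm; apply: meager_sub m.
by move=> g [/UV ? /AB ?].
Qed.

Lemma open_mul_split U (g h : G) : open U -> U (g * h)%g ->
  exists V W, [/\ open V, open W, V g, W h &
    forall v w, V v -> W w -> U (v * w)%g].
Proof.
move=> oU Ugh.
have /mulg_continuous : nbhs ((g, h).1 * (g, h).2)%g U.
  by apply: open_nbhs_nbhs.
move=> [[P Q] /= [nP nQ] PQ]; exists P°, Q°; split=> //; try exact: open_interior.
move=> v w /interior_subset Pv /interior_subset Qw.
exact: (PQ (v, w)).
Qed.

Lemma open_lmul (g : G) U : open U -> open [set h | U (g * h)%g].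
Proof.
move=> oU; rewrite openE => h Ugh.
have [V [W [_ oW Vg Wh VW]]] := open_mul_split oU Ugh.
by apply: (filterS _ (open_nbhs_nbhs (conj oW Wh))) => w; apply: VW.
Qed.

Lemma open_inv U : open U -> open [set h | U (h^-1)%g].
Proof. by move=> oU; apply: (continuousP _).1 oU; apply: invg_continuous. Qed.

Lemma meager_lmul (g : G) U : meager U -> meager [set h | U (g * h)%g].
Proof.
apply: (@meager_homeo _ _ (fun h => g^-1 * h)%g).
- by move=> h; rewrite mulKg.
- by move=> h; rewrite mulVKg.
- by move=> W; apply: open_lmul.
- by move=> W; apply: open_lmul.
Qed.

(** Equivariance in the form g^-1 (U * A) = (g^-1 U) * A; left translations are homeomorphisms and
    so preserve meagerness. *)
Lemma vaught_act U A (g : G) x : vaught alpha U A (alpha (g, x)) <->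
  vaught alpha [set h | U (g * h)%g] A x.
Proof.
have E h : alpha (h^-1%g, alpha (g, x)) = alpha ((g^-1 * h)^-1%g, x).
  by rewrite -act_alpha.2 invgM invgK.
rewrite !vaughtE; split=> nm m; apply: nm.
  apply: meager_sub (meager_lmul (g^-1)%g m) => h [Uh]; rewrite E => Ah.
  by split=> //=; rewrite mulVKg.
apply: meager_sub (meager_lmul g m) => h /= [Uh Ah].
by split=> //; rewrite E mulKg.
Qed.

(** The transform depends on [U] only modulo meager sets, so the Baire property replaces [U] by an
    open set that serves for all [A] at once. *)
Lemma borel_vaught_open U : borel G U ->
  exists2 V, open V & forall A, vaught alpha U A = vaught alpha V A.
Proof.
move=> /borel_baire_property[V oV m]; exists V => // A; rewrite !vaughtE.
apply/seteqP; split=> x nm m'; apply: nm; apply: meager_sub (meagerU m m').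
  move=> g [Ug Ag]; have [Vg|nVg] := pselect (V g); first by right.
  by left; left.
move=> g [Vg Ag]; have [Ug|nUg] := pselect (U g); first by right.
by left; right.
Qed.

Lemma section_borel (BX : set_system X) A x : borel_action BX alpha -> BX A ->
  borel G [set g | A (alpha (g^-1%g, x))].
Proof.
move=> ba BA.
apply: (@borel_preimage _ (fun g : G => g^-1)%g [set g | A (alpha (g, x))]).
  exact: open_inv.
suff sub : <<s rectangles (borel G) BX >> `<=`
    [set E | borel G [set g | E (g, x)]] by exact: sub (ba A BA).
apply: smallest_sub.
  have [s0 sC sU] := @smallest_sigma_algebra G setT open.
  split.
  - exact: s0.
  - by move=> E bE; rewrite setTD; have := sC _ bE; rewrite setTD.
  - by move=> E bE; have := sU _ bE.
move=> _ [U bU [B BB <-]] /=.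
have [Bx|nBx] := pselect (B x).
  suff -> : [set g | (U `*` B) (g, x)] = U by [].
  by apply/seteqP; split=> g; [move=> []|split].
suff -> : [set g | (U `*` B) (g, x)] = set0.
  by have [] := @smallest_sigma_algebra G setT open.
by rewrite -subset0 => g [].
Qed.

(** * Vaught transforms over a countable base of the group *)

Section Base.
Variable u : nat -> set G.
Hypotheses (uE : @open G = base_topology u) (qpu : quasi_polish_base u).

Lemma open_u i : open (u i).
Proof. by rewrite uE; apply: base_topology_base. Qed.

Lemma nonmeagerT : ~ meager [set: G].
Proof. exact: (@quasi_polish_nonmeager _ u 1%g). Qed.

(** If the preimage of [A] is the union of rectangles U_n x A_n, then [A] is the union of the U_n *
    A_n: for [x] in [A] all pairs (g, g^-1 x) lie in the preimage, so some rectangle contains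
    nonmeagerly many of them; conversely, one such pair puts [x] into [A]. *)
Lemma otimes_vaught (H : set_system G) (S : set_system X) A :
  otimes H S (alpha @^-1` A) -> vaught_unions alpha H S A.
Proof.
move=> /countable_unionsP[q [E [ER AE]]].
have /choice[UB UBP] : forall n, exists UB : set G * set X, q n ->
    [/\ H UB.1, S UB.2 & E n = UB.1 `*` UB.2].
  move=> n; have [/ER[U HU [B SB UB]]|nq] := pselect (q n).
    by exists (U, B) => _; split.
  by exists (set0, set0).
suff -> : A = \bigcup_(n in q) vaught alpha (UB n).1 (UB n).2.
  apply: countable_unions_bigcup => n /UBP[HU SB _].
  by exists (UB n).1 => //; exists (UB n).2.
have memA g x : A (alpha (g, x)) <-> exists2 n, q n & (UB n).1 g /\ (UB n).2 x.
  rewrite -[A _]/((alpha @^-1` A) (g, x)) AE; split=> -[n qn].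
    by have [_ _ ->] := UBP n qn => -[? ?]; exists n.
  by move=> ?; exists n => //; have [_ _ ->] := UBP n qn.
apply/seteqP; split=> x.
  move=> Ax; have [|g _ _|n qn nx] :=
      @vaught_cover _ q (fst \o UB) (snd \o UB) setT setT x; last by exists n.
    by rewrite vaughtE => m; apply: nonmeagerT; apply: meager_sub m.
  by apply/memA; rewrite actVK.
move=> [n qn nx]; apply: contrapT => nAx; move: nx; rewrite vaughtE; apply.
apply: (@meager_sub _ _ set0); last exact/nowhere_dense_meager/nowhere_dense0.
move=> g [Ug Bg]; apply: nAx; rewrite -(actVK g x); apply/memA.
by exists n.
Qed.

(** One inclusion of the formula for the preimage of U * A under the action, as the union of the
    rectangles u_k x (u_l * A) with u_k u_l inside [U]. Continuity of multiplication supplies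
    countably many pairs, one of which has a nonmeager contribution. *)
Lemma vaught_act_nbhs U A (g : G) x : open U -> vaught alpha U A (alpha (g, x)) ->
  exists k l, [/\ u k g, vaught alpha (u l) A x &
    forall v w, u k v -> u l w -> U (v * w)%g].
Proof.
move=> oU /vaught_act.
pose q := [set kl : nat * nat | u kl.1 g /\
  forall v w, u kl.1 v -> u kl.2 w -> U (v * w)%g].
move=> /(@vaught_cover _ q (fun kl => u kl.2) (fun=> A))[h Ugh Ah|[k l] [kg kl] lx].
  have [V [W [oV oW Vg Wh VW]]] := open_mul_split oU Ugh.
  move: oV oW; rewrite uE => /(_ g Vg)[k kg kV] /(_ h Wh)[l lh lW].
  by exists (k, l) => //; split=> // v w /kV Vv /lW Ww; apply: VW.
by exists k, l.
Qed.

Lemma vaught_act_rect U A k l (g : G) x :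
  u k g -> vaught alpha (u l) A x ->
  (forall v w, u k v -> u l w -> U (v * w)%g) -> vaught alpha U A (alpha (g, x)).
Proof.
move=> kg lx kl; apply/vaught_act; apply: vaught_sub lx => // w lw.
exact: kl.
Qed.

Lemma vaught_otimes (S : set_system X) A :
  vaught_unions alpha open S A ->
  otimes open (vaught_unions alpha open S) (alpha @^-1` A).
Proof.
move=> /countable_unionsP[q [E [ER ->]]].
have /choice[UB UBP] : forall n, exists UB : set G * set X, q n ->
    [/\ open UB.1, S UB.2 & E n = vaught alpha UB.1 UB.2].
  move=> n; have [/ER[U oU [B SB UB]]|nq] := pselect (q n).
    by exists (U, B) => _; split.
  by exists (set0, set0).
pose p := [set nkl : nat * (nat * nat) | q nkl.1 /\
  forall v w, u nkl.2.1 v -> u nkl.2.2 w -> (UB nkl.1).1 (v * w)%g].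
suff -> : alpha @^-1` (\bigcup_(n in q) E n) = \bigcup_(nkl in p)
    (u nkl.2.1 `*` vaught alpha (u nkl.2.2) (UB nkl.1).2).
  apply: countable_unions_bigcup => -[n [k l]] /= [qn _].
  exists (u k); first exact: open_u.
  exists (vaught alpha (u l) (UB n).2) => //.
  apply: countable_unions1; exists (u l); first exact: open_u.
  by exists (UB n).2 => //; have [] := UBP n qn.
apply/seteqP; split=> -[g x] /=.
  move=> [n qn]; have [oU SB ->] := UBP n qn.
  by move=> /(vaught_act_nbhs oU)[k [l [kg lx kl]]]; exists (n, (k, l)).
move=> [[n [k l]] [/= qn kl] [kg lx]]; exists n => //.
by have [oU SB ->] := UBP n qn; apply: vaught_act_rect kg lx kl.
Qed.

Lemma continuous_action_otimes (S O : set_system X) (b : nat -> set X) A :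
  O = base_topology b -> O `<=` S -> continuous_action O alpha -> O A ->
  otimes open S (alpha @^-1` A).
Proof.
move=> OE OS cont /cont[D DR AE].
pose q := [set ki : nat * nat | u ki.1 `*` b ki.2 `<=` alpha @^-1` A].
suff -> : alpha @^-1` A = \bigcup_(ki in q) (u ki.1 `*` b ki.2).
  apply: countable_unions_bigcup => -[k i] _.
  exists (u k); first exact: open_u.
  by exists (b i) => //; apply: OS; rewrite OE; apply: base_topology_base.
apply/seteqP; split=> -[g x]; last by move=> [ki + ?]; apply.
rewrite AE => -[E DE Egx]; have [U oU [B OB UB]] := DR _ DE.
move: Egx; rewrite -UB => -[/= Ug Bx].
move: oU OB; rewrite uE OE => /(_ g Ug)[k kg kU] /(_ x Bx)[i ix iB].
exists (k, i) => // -[h y] [/= /kU Uh /iB By].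
suff : (\bigcup_(B in D) B) (h, y) by rewrite -AE.
by exists E => //; rewrite -UB.
Qed.

(** If the preimage of [A] is the union of the U_n x A_n, then g A is the union of those A_n for
    which U_n contains g^-1. *)
Lemma otimes_translates (H : set_system G) (S : set_system X) A :
  sigma_topology S -> otimes H S (alpha @^-1` A) ->
  (forall g : G, S (translate alpha g A)) /\
  (exists C : set_system X, [/\ countable C, C `<=` S &
     forall g : G, unions C (translate alpha g A)]).
Proof.
move=> [_ _ SU] /countable_unionsP[q [E [ER AE]]].
have /choice[UB UBP] : forall n, exists UB : set G * set X, q n ->
    S UB.2 /\ E n = UB.1 `*` UB.2.
  move=> n; have [/ER[U HU [B SB UB]]|nq] := pselect (q n).
    by exists (U, B).
  by exists (set0, set0).
have trE g : translate alpha g A =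
    \bigcup_(n in [set n | q n /\ (UB n).1 g^-1%g]) (UB n).2.
  rewrite translateE; apply/seteqP; split=> x.
    rewrite -[X in X -> _]/((alpha @^-1` A) (g^-1%g, x)) AE => -[n qn].
    by have [_ ->] := UBP n qn => -[/= ? ?]; exists n.
  move=> [n [qn Ug] Bx].
  suff : (alpha @^-1` A) (g^-1%g, x) by [].
  by rewrite AE; exists n => //; have [_ ->] := UBP n qn.
split=> [g|].
  by rewrite trE; apply: SU; apply: countable_unions_bigcup => n [/UBP[]].
exists [set (UB n).2 | n in q]; split.
- exact: countable_image (countableP _).
- by move=> _ [n /UBP[? _] <-].
- move=> g; rewrite trE.
  exists [set (UB n).2 | n in [set n | q n /\ (UB n).1 g^-1%g]].
    by move=> _ [n [qn _] <-]; exists n.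
  by rewrite bigcup_image.
Qed.

(* The sets P n = {g | g . e n `<=` A} are only coanalytic; passing to their
   open hulls Q n makes their definability irrelevant, since the sets
   {g | g^-1 . x \in e n} have the Baire property. *)
Lemma translates_vaught (BX S : set_system X) A :
  borel_action BX alpha -> S `<=` BX -> S set0 ->
  (exists C : set_system X, [/\ countable C, C `<=` S &
     forall g : G, unions C (translate alpha g A)]) ->
  vaught_unions alpha open S A.
Proof.
move=> ba SB S0 [C [cC CS CA]].
have [e [eC _ Ce]] := countable_enum set0 cC.
have eS n : S (e n) by have [/CS|->] := eC n.
pose P n := [set g | e n `<=` [set x | A (alpha (g, x))]].
have /choice[Q QP] n := open_hull (P n) uE.
suff -> : A = \bigcup_(n in setT) vaught alpha (Q n) (e n).
  apply: countable_unions_bigcup => n _; exists (Q n); first by have [] := QP n.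
  by exists (e n).
apply/seteqP; split=> x.
  move=> Ax; have [|n _ nm] := @nonmeager_cover _ _ setT
      (fun n => [set g | P n g /\ e n (alpha (g^-1%g, x))]) _ nonmeagerT.
    move=> g _; have [D DC AD] := CA g^-1%g.
    have : translate alpha g^-1%g A (alpha (g^-1%g, x)) by exists x.
    rewrite AD => -[B DB Bx]; have [n en] := Ce _ (DC _ DB).
    exists n => //; split; last by rewrite en.
    move=> y; rewrite en => By.
    have : translate alpha g^-1%g A y by rewrite AD; exists B.
    by rewrite translateE /= invgK.
  exists n => //; rewrite vaughtE => m; apply: nm.
  have [_ mPQ _] := QP n; apply: meager_sub (meagerU mPQ m) => g [Pg eg].
  by have [Qg|nQg] := pselect (Q n g); [right|left].
move=> [n _]; rewrite vaughtE => nm; have [oQ _ QW] := QP n.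
have [V oV mV] := borel_baire_property (section_borel x ba (SB _ (eS n))).
(* [V] agrees with the section of [e n] at [x] up to a meager set, and [P n] is nonmeager in every
   nonempty open part of its hull; hence some [g] in [P n] has g^-1 x in [e n]. *)
have /QW/(_ _ (@subIsetl _ _ _)) : open (Q n `&` V) by apply: openI.
have [QV /(_ QV) nmP|noQV _] := pselect ((Q n `&` V) !=set0); last first.
  exfalso; apply: nm; apply: meager_sub mV => g [Qg eg].
  by left; split=> // Vg; apply: noQV; exists g.
have [g [Pg [Qg Vg]] ng] : exists2 g, (P n `&` (Q n `&` V)) g &
    e n (alpha (g^-1%g, x)).
  apply: contrapT => no; apply: nmP; apply: meager_sub mV => g Pg.
  by right; split=> [|eg]; [have [_ []] := Pg|apply: no; exists g].
by rewrite -(actVK g x); apply: Pg.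
Qed.

(** If [x] and [y] lie in the same transforms, their sections of each [c i] agree modulo a meager
    set. Some [g] avoids all these differences, so that g^-1 x and g^-1 y lie in the same sets [c i]
    and coincide. *)
Lemma separating_vaught (BX : set_system X) (I : countType) (c : I -> set X) :
  borel_action BX alpha -> (forall i, BX (c i)) -> separating c ->
  separating (fun ki : nat * I => vaught alpha (u ki.1) (c ki.2)).
Proof.
move=> ba cB sep x y same.
pose sec x i := [set g | c i (alpha (g^-1%g, x))].
have mD x' y' i : (forall k, vaught alpha (u k) (c i) x' ->
    vaught alpha (u k) (c i) y') -> meager (sec x' i `\` sec y' i).
  move=> sub; apply: contrapT => nm.
  have [|W oW mW] := @borel_baire_property G (sec x' i `\` sec y' i).
    apply: borelD; exact: section_borel ba (cB i).
  (* A nonmeager difference is comeager in some [W]. A basic set inside [W] then meets the section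
     of [x] nonmeagerly but that of [y] only in a meager set. *)
  have [|g Dg|k kW nmk] := @nonmeager_cover _ _ [set k | u k `<=` W]
      (fun k => u k `&` sec x' i) ((sec x' i `\` sec y' i) `&` W).
  - by move=> m; apply: nm; apply: meager_sub (meagerU mW m) => g Dg;
      have [Wg|nWg] := pselect (W g); [right|left; left].
  - case: Dg => -[xg _] Wg; move: oW; rewrite uE => /(_ g Wg)[k kg kW].
    by exists k.
  have := sub k; rewrite vaughtE => /(_ nmk); apply.
  apply: meager_sub mW => g [kg yg]; right; split; first exact: kW.
  by move=> [].
pose N := \bigcup_(i in setT) ((sec x i `\` sec y i) `|` (sec y i `\` sec x i)).
have mN : meager N.
  by apply: meager_bigcup => i _; apply: meagerU; apply: mD => k /(same (k, i)).
have [g nNg] : exists g, ~ N g.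
  apply: contrapT => all; apply: nonmeagerT; apply: meager_sub mN => g _.
  by apply: contrapT => nNg; apply: all; exists g.
rewrite -(actVK g x) -(actVK g y); congr (alpha (_, _)); apply: sep => i.
by split=> cg; apply: contrapT => ncg; apply: nNg; exists i => //;
  [left|right].
Qed.

Lemma vaught_closed_topology (R : realType) (BX S D : set_system X) :
  borel_action BX alpha -> compatible_sigma_topology R BX S ->
  vaught_unions alpha open S `<=` S -> countable D -> D `<=` S ->
  exists O : set_system X,
    [/\ quasi_polish_topology R O, O `<=` S, continuous_action O alpha &
        countable_unions [set vaught alpha U B | U in open & B in D] `<=` O].
Proof.
move=> ba [[ST SI SU] SB Scomp] stab cD DS.
have vS U A : open U -> S A -> S (vaught alpha U A).
  by move=> oU SA; apply: stab; apply: countable_unions1; exists U => //; exists A.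
(* One enlargement: a quasi-Polish topology inside [S] in which the [b i] and their transforms by
   basic open sets of [G] are open. Its iterates are joined into the base [c], closed under these
   transforms. *)
have /choice[F FP] : forall b : nat -> set X, exists b' : nat -> set X,
    (forall i, S (b i)) -> [/\ forall i, S (b' i), quasi_polish_base b',
      forall i, base_topology b' (b i) &
      forall k i, base_topology b' (vaught alpha (u k) (b i))].
  move=> b; have [Sb|nS] := pselect (forall i, S (b i)); last by exists b.
  pose h (t : nat + nat * nat) := match t with
    inl i => b i | inr (k, i) => vaught alpha (u k) (b i) end.
  have [||O [[qO _] hO OS]] := Scomp (range h).
  - exact: countable_image (countableP _).
  - by move=> _ [[i|[k i]] _ <-] //=; apply: vS => //; apply: open_u.
  have [b' qb OE] := quasi_polish_has_base qO.
  exists b' => _; split=> //.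
  - by move=> i; apply: OS; rewrite OE; apply: base_topology_base.
  - by move=> i; rewrite -OE; apply: hO; exists (inl i).
  - by move=> k i; rewrite -OE; apply: hO; exists (inr (k, i)).
have [e0 [e0D _ De0]] := countable_enum setT cD.
have e0S n : S (e0 n) by have [/DS|->] := e0D n.
pose b n := iter n F (F e0).
have bS n i : S (b n i).
  elim: n i => [|n IH] i; first by have [+ _ _ _] := FP _ e0S; apply.
  by have [+ _ _ _] := FP _ IH; apply.
have qpb n : quasi_polish_base (b n).
  case: n => [|n]; first by have [] := FP _ e0S.
  by have [] := FP _ (bS n).
have bF n := FP _ (bS n).
pose c (mi : nat * nat) := b mi.1 mi.2.
have qpc : quasi_polish_base c.
  by apply: quasi_polish_base_join => // m i; have [_ _ + _] := bF m; apply.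
have cv k mi : base_topology c (vaught alpha (u k) (c mi)).
  move=> x; have [_ _ _ H] := bF mi.1; move=> /H[j jx jS].
  by exists (mi.1.+1, j).
have cD' B : D B -> base_topology c B.
  move=> /De0[n <-] x; have [_ _ H _] := FP _ e0S; move=> /H[j jx jS].
  by exists (0%N, j).
pose e (kmi : nat * (nat * nat)) := vaught alpha (u kmi.1) (c kmi.2).
have eS kmi : S (e kmi) by apply: vS; [apply: open_u|apply: bS].
(* The fiber of the action over [x] consists of the points (g, g^-1 x); a subset is large when its
   projection to [G] is nonmeager. *)
have qpe : quasi_polish_base e.
  apply: (quasi_polish_base_pushforward (f := alpha)
    (quasi_polish_base_prod qpu qpc)).
  - move=> [k mi] /= T; apply/seteqP; split=> // x _; rewrite /e vaughtE => m.
    apply: nonmeagerT; apply: meager_sub m => g _.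
    by have : [set: G * X] (g, alpha (g^-1%g, x)) by []; rewrite -T.
  - move=> [k mi] x q ex cov; apply: (vaught_cover ex) => g kg cg.
    have [//||l ql [lg lx]] := cov (g, alpha (g^-1%g, x)); first exact: actVK.
    by exists l.
  - move=> [k mi] [g x] /= /(vaught_act_nbhs (open_u k))[k' [l [k'g lx kl]]].
    have [mj jx jS] := cv l mi x lx.
    exists (k', mj) => // -[h y] [/= k'h /jS ly].
    exact: vaught_act_rect k'h ly kl.
  - apply: (separating_vaught ba) => [mi|]; first exact/SB/bS.
    by have [] := qpc.
exists (base_topology e); split.
- exact: quasi_polish_base_topology.
- move=> A oA.
  suff -> : A = \bigcup_(i in [set i | e i `<=` A]) e i.
    by apply: SU; apply: countable_unions_bigcup.
  apply/seteqP; split=> x; last by move=> [i iA /iA].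
  by move=> /oA[i ix iA]; exists i.
- move=> A oA.
  pose Q := [set klmi : nat * (nat * (nat * nat)) |
    u klmi.1 `*` e klmi.2 `<=` alpha @^-1` A].
  exists [set u kl.1 `*` e kl.2 | kl in Q].
    move=> _ [[k l] _ <-]; exists (u k); first exact: open_u.
    by exists (e l) => //; apply: base_topology_base.
  rewrite bigcup_image; apply/seteqP; split=> -[g x]; last first.
    by move=> [kl + ?]; apply.
  move=> /oA[[k mi] /= /(vaught_act_nbhs (open_u k))[k' [l [k'g lx kl]]] eA].
  exists (k', (l, mi)) => // -[h y] [/= k'h ly]; apply: eA.
  exact: vaught_act_rect k'h ly kl.
- move=> _ [D' [_ D'S ->]]; apply: base_topology_unions.
  move=> _ /D'S[U oU [B DB <-]] x.
  pose q := [set kmi : nat * (nat * nat) | u kmi.1 `<=` U /\ c kmi.2 `<=` B].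
  move=> /(@vaught_cover _ q (fun kmi => u kmi.1) (fun kmi => c kmi.2)).
  case=> [g Ug Bg|[k mi] [/= kU cB] ex].
    have [mi mix miB] := cD' _ DB _ Bg.
    move: oU; rewrite uE => /(_ g Ug)[k kg kU].
    by exists (k, mi).
  by exists (k, mi) => //; apply: vaught_sub.
Qed.

End Base.
End GroupAction.

(** * Equivalence of the conditions and simultaneous realization *)

Theorem theorem3p3p2 (R : realType) (G : topologicalGroupType)
    (polishG : polish_topology R (@open G))
    (X : Type) (BX : set_system X) (sbX : standard_borel R BX)
    (alpha : G * X -> X)
    (act_alpha : is_action alpha) (borel_alpha : borel_action BX alpha)
    (S : set_system X) (compS : compatible_sigma_topology R BX S)
    (stabS : vaught_unions alpha (@open G) S `<=` S) :
  [/\ vaught_unions alpha (borel G) S = vaught_unions alpha (@open G) S,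
      (forall A : set X, BX A ->
        [<-> exists O : set_system X,
               [/\ quasi_polish_topology R O, O `<=` S,
                   continuous_action O alpha & O A];
             vaught_unions alpha (@open G) S A;
             otimes (borel G) S (alpha @^-1` A);
             otimes (@open G) S (alpha @^-1` A);
             otimes (@open G) (vaught_unions alpha (@open G) S)
               (alpha @^-1` A);
             (forall g : G, S (translate alpha g A)) /\
             (exists C : set_system X,
               [/\ countable C, C `<=` S &
                   forall g : G, unions C (translate alpha g A)])]),
      (forall A : set X, S A -> (forall g : G, translate alpha g A = A) ->
        exists O : set_system X,
          [/\ quasi_polish_topology R O, O `<=` S,
              continuous_action O alpha & O A]) &
      (forall F : set_system X, countable F -> F `<=` BX ->
        (forall A : set X, F A ->
          exists O : set_system X,
            [/\ quasi_polish_topology R O, O `<=` S,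
                continuous_action O alpha & O A]) ->
        exists O : set_system X,
          [/\ quasi_polish_topology R O, O `<=` S,
              continuous_action O alpha & F `<=` O])].
Proof.
have [|u qpu uE] := @quasi_polish_has_base R G open.
  by have [cb [d [? _ ? ?]]] := polishG; split=> //; exists d.
have [[ST SI SU] SB _] := compS.
have S0 : S set0.
  by apply: SU; exists set0; split=> //; rewrite bigcup_set0.
have otimes_sub (H H' : set_system G) (K K' : set_system X) : H `<=` H' ->
    K `<=` K' -> otimes H K `<=` otimes H' K'.
  move=> HH KK _ [D [cD DR ->]]; exists D; split=> // E /DR[U HU [B KB <-]].
  by exists U; [apply: HH|exists B => //; apply: KK].
have open_borel : @open G `<=` borel G by apply: sub_sigma_algebra.
have borelE : vaught_unions alpha (borel G) S = vaught_unions alpha open S.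
  apply/seteqP; split=> A [D [cD DV ->]]; exists D; split=> // B /DV.
    move=> [U /(borel_vaught_open act_alpha)[V oV VE] [C SC <-]].
    by exists V => //; exists C; rewrite ?VE.
  by move=> [U oU [C SC <-]]; exists U; [apply: open_borel|exists C].
(* The implications run (i) to (iv) to (iii) to (ii) to (i), with the detours (ii) to (v) to (iv)
   and (iv) to (vi) to (i). *)
have i_iv A : (exists O : set_system X, [/\ quasi_polish_topology R O, O `<=` S,
    continuous_action O alpha & O A]) -> otimes open S (alpha @^-1` A).
  move=> [Op [/quasi_polish_has_base[b _ OE] OS cont OA]].
  exact: (continuous_action_otimes uE OE OS cont OA).
have iii_ii A : otimes (borel G) S (alpha @^-1` A) -> vaught_unions alpha open S A.
  by rewrite -borelE; apply: otimes_vaught uE qpu _ _ _.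
have ii_v A : vaught_unions alpha open S A ->
    otimes open (vaught_unions alpha open S) (alpha @^-1` A).
  exact: (vaught_otimes act_alpha uE).
have v_iv A : otimes open (vaught_unions alpha open S) (alpha @^-1` A) ->
    otimes open S (alpha @^-1` A) by apply: otimes_sub.
have iv_iii A : otimes open S (alpha @^-1` A) ->
    otimes (borel G) S (alpha @^-1` A) by apply: otimes_sub.
have simul (F : set_system X) : countable F ->
    F `<=` vaught_unions alpha open S ->
    exists O : set_system X, [/\ quasi_polish_topology R O, O `<=` S,
      continuous_action O alpha & F `<=` O].
  move=> cF FV.
  (* [D A] collects the sets whose transforms represent [A]; the union over [F] is still countable,
     so a single topology closed under transforms serves the whole family. *)
  have /choice[D DP] : forall A, exists D : set_system X, F A ->
      [/\ countable D, D `<=` S &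
        countable_unions [set vaught alpha U B | U in open & B in D] A].
    move=> A; have [/FV/countable_unionsP[q [E [ER AE]]]|nF] := pselect (F A);
      last by exists set0.
    have /choice[UB UBP] : forall n, exists UB : set G * set X, q n ->
        [/\ open UB.1, S UB.2 & vaught alpha UB.1 UB.2 = E n].
      move=> n; have [/ER[U oU [B SB' <-]]|nq] := pselect (q n).
        by exists (U, B).
      by exists (set0, set0).
    exists [set (UB n).2 | n in q] => _; split.
    - exact: countable_image (countableP _).
    - by move=> _ [n /UBP[] + + _ <-].
    - rewrite AE; apply: countable_unions_bigcup => n qn.
      have [oU _ <-] := UBP n qn.
      by exists (UB n).1 => //; exists (UB n).2 => //; exists n.
  have [||O [qO OS cont VO]] := @vaught_closed_topology _ _ _ act_alpha u uE qpu R
      BX S (\bigcup_(A in F) D A) borel_alpha compS stabS.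
  - by apply: bigcup_countable => // A /DP[].
  - by move=> B [A /DP[_ DS _] /DS].
  exists O; split=> // A FA; apply: VO; have [_ _ [E [cE EV ->]]] := DP A FA.
  exists E; split=> // _ /EV[U oU [B DB <-]]; exists U => //; exists B => //.
  by exists A.
have ii_i A : vaught_unions alpha open S A ->
    exists O : set_system X, [/\ quasi_polish_topology R O, O `<=` S,
      continuous_action O alpha & O A].
  move=> VA; have [||O [? ? ? AO]] := simul [set A].
  - exact: countable1.
  - by move=> _ ->.
  - by exists O; split=> //; apply: AO.
have vi_i A : (exists C : set_system X, [/\ countable C, C `<=` S &
    forall g : G, unions C (translate alpha g A)]) ->
    exists O : set_system X, [/\ quasi_polish_topology R O, O `<=` S,
      continuous_action O alpha & O A].
  by move=> CA; apply: ii_i; apply: (translates_vaught act_alpha uE qpu borel_alpha).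
split=> //.
- move=> A BA; tfae.
  + by move=> /i_iv/iv_iii/iii_ii.
  + by move=> /ii_v/v_iv/iv_iii.
  + by move=> /iii_ii/ii_v/v_iv.
  + by move=> /iv_iii/iii_ii/ii_v.
  + by move=> /v_iv; apply: otimes_translates.
  + by move=> [_ /vi_i].
- move=> A SA inv; apply: vi_i; exists [set A]; split.
  + exact: countable1.
  + by move=> _ ->.
  + by move=> g; rewrite inv; exists [set A]; rewrite ?bigcup_set1.
- by move=> F cF _ FP; apply: simul => // A /FP/i_iv/iv_iii/iii_ii.
Qed.
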